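(* Let $\Gamma=(X_i,A_i,B_i,P_i,a_i,b_i,p_i)_{i\in I}$ be a fuzzy abstract economy, $X=\prod_{i\in I}X_i$, with $A_i'(x)=(A_{i_x})_{a_i(x)}$, $B_i'(x)=(B_{i_x})_{b_i(x)}$, $P_i'(x)=(P_{i_x})_{p_i(x)}$ for $x\in X$. Suppose that for each $i\in I$ the following conditions are fulfilled: 1) $X_i$ is a nonempty compact convex subset of a locally convex Hausdorff topological vector space $E_i$, and $D_i$ is a nonempty compact convex subset of $X_i$; 2) for each $x\in X$, $B_i'(x)$ is a nonempty convex subset of $X_i$, $A_i'(x)$ and $P_i'(x)$ are convex, and $A_i'(x)\cap P_i'(x)\subset B_i'(x)$; 3) the set $W_i=\{x\in X: A_i'(x)\cap P_i'(x)\neq\emptyset\}$ is open in $X$; 4) the correspondence $H_i:X\to 2^{X_i}$ defined by $H_i(x)=A_i'(x)\cap P_i'(x)$ for each $x\in X$ is almost w-upper semicontinuous with respect to $D_i$ on $W_i$, and $\overline{H_i^{V_i}}$ is convex nonempty valued on $W_i$ for each open absolutely convex symmetric neighborhood $V_i$ of $0$ in $E_i$, where $H_i^{V_i}(x)=(H_i(x)+V_i)\cap D_i$; 5) the correspondence $B_i':X\to 2^{X_i}$ is almost w-upper semicontinuous with respect to $D_i$, and $\overline{B_i^{V_i}}$ is convex nonempty valued for each open absolutely convex symmetric neighborhood $V_i$ of $0$ in $E_i$, where $B_i^{V_i}:X\to 2^{X_i}$ is defined by $B_i^{V_i}(x)=(B_i'(x)+V_i)\cap D_i$; 6) for each $x\in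 X$, $x_i\notin\overline{H_i}(x)$. Then there exists a fuzzy equilibrium point $x^*\in D=\prod_{i\in I}D_i$, that is, for each $i\in I$, $x_i^*\in\overline{B_i'}(x^* )$ and $A_i'(x^* )\cap P_i'(x^* )=\emptyset$.
   Context: A correspondence $T:X\to 2^Y$ assigns to each point of $X$ a (possibly empty) subset of $Y$; $\mathrm{Gr}(T)=\{(x,y)\in X\times Y: y\in T(x)\}$. For topological spaces $X,Y$, $\overline{T}:X\to 2^Y$ is defined by $\overline{T}(x)=\{y\in Y:(x,y)\in \mathrm{cl}_{X\times Y}\mathrm{Gr}(T)\}$. $T$ is upper semicontinuous if for each $x\in X$ and each open $V\subset Y$ with $T(x)\subset V$ there is an open neighborhood $U$ of $x$ in $X$ such that $T(y)\subset V$ for all $y\in U$. Let $X$ be a topological space, $Y$ a nonempty subset of a topological vector space $E$, $D\subset Y$, and $T:X\to 2^Y$. For a neighborhood $V$ of $0$ in $E$, $T^V:X\to 2^Y$ is $T^V(x)=(T(x)+V)\cap D$. $T$ is almost w-upper semicontinuous with respect to $D$ if there exists a basis $\mathcal{B}$ of open symmetric neighborhoods of $0$ in $E$ such that for each $V\in\mathcal{B}$ the correspondence $\overline{T^V}$ is upper semicontinuous. ''On $W$'' (for $W\subset X$) means that the restriction of $T$ to $W$ has this property. A fuzzy set on $Y$ is a function $A:Y\to[0,1]$; $\mathcal{F}(Y)$ is the collection of fuzzy sets on $Y$; for $q\in[0,1]$, the $q$-cut set is $(A)_q=\{y\in Y:A(y)\ge q\}$. A fuzzy mapping $F:X\to\mathcal{F}(Y)$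 assigns to each $x$ a fuzzy set $F_x$ on $Y$. A fuzzy abstract economy is a family $\Gamma=(X_i,A_i,B_i,P_i,a_i,b_i,p_i)_{i\in I}$, where $I$ is a nonempty set (of agents), $X_i$ is the nonempty set of actions of agent $i$, $X=\prod_{i\in I}X_i$ (with the product topology), $A_i,B_i:X\to\mathcal{F}(X_i)$ are the constraint fuzzy mappings, $P_i:X\to\mathcal{F}(X_i)$ is the preference fuzzy mapping, and $a_i,b_i,p_i:X\to(0,1]$ are functions. $A_{i_x}$, $B_{i_x}$, $P_{i_x}$ denote the fuzzy sets $A_i(x),B_i(x),P_i(x)$. A fuzzy equilibrium for $\Gamma$ is a point $x^*\in X$ such that for each $i\in I$, $x_i^*\in\overline{B_i'}(x^* )$ and $A_i'(x^* )\cap P_i'(x^* )=\emptyset$. *)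

(* Defs.v *)
From HB Require Import structures.
Set Warnings "-notation-overridden,-ambiguous-paths,-notation-incompatible-prefix".
From mathcomp Require Import all_boot all_order all_algebra.
From mathcomp Require Import interval_inference.
From mathcomp Require Import boolp classical_sets functions reals topology.
From mathcomp Require Import convex tvs.

Set Implicit Arguments.
Unset Printing Implicit Defensive.

Import Order.TTheory GRing.Theory Num.Theory.

Local Open Scope classical_set_scope.
Local Open Scope ring_scope.

(* A correspondence T : X -> 2^Y is a function T : X -> set Y.  When Y is a
   subset of a topological space, it stands for the subtype [set_type Y] with the
   subset topology, and [set_val] is the inclusion.  The correspondence
   [closure_corr T] is written \overline{T} on paper: its graph is the closure
   of the graph of T in the product X * Y. *)

Section correspondence.
Context {X Y : topologicalType}.

Definition graph (T : X -> set Y) : set (X * Y) := [set z | T z.1 z.2].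

Definition closure_corr (T : X -> set Y) : X -> set Y :=
  fun x => [set y | closure (graph T) (x, y)].

Definition upper_semicontinuous (T : X -> set Y) : Prop :=
  forall (x : X) (V : set Y), open V -> T x `<=` V ->
    exists2 U : set X, open_nbhs x U & forall x', U x' -> T x' `<=` V.

End correspondence.

Section tvs_sets.
Context {R : realType} {E : lmodType R}.

Definition symmetric_set (V : set E) : Prop := forall v, V v -> V (- v).

Definition balanced (V : set E) : Prop :=
  forall (a : R) (v : E), `|a| <= 1 -> V v -> V (a *: v).

Definition absolutely_convex (V : set E) : Prop := convex_set V /\ balanced V.

(* A set of points of the subtype Y is convex when it is convex in E. *)
Definition convex_subset {Y : set E} (A : set Y) : Prop :=
  convex_set (set_val @` A : set E).

End tvs_sets.

Section almost_w_usc.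
Context {R : realType} {X : topologicalType} {E : topologicalLmodType R}.
Context {Y : set E}.

(* T^V(x) = (T(x) + V) :&: D; the sum is formed in E, and need not lie in Y. *)
Definition enlarge (T : X -> set Y) (D : set Y) (V : set E) : X -> set Y :=
  fun x => [set y | [set a + b | a in set_val @` T x & b in V] (set_val y)]
           `&` D.

Definition almost_w_usc (D : set Y) (T : X -> set Y) : Prop :=
  exists B : set_system E,
    [/\ forall V, B V -> open_nbhs (0 : E) V /\ symmetric_set V,
        forall U, nbhs (0 : E) U -> exists2 V, B V & V `<=` U
      & forall V, B V -> upper_semicontinuous (closure_corr (enlarge T D V))].

End almost_w_usc.

(* The restriction of T to W is a correspondence on W with the subset topology,
   so closures of graphs are taken in W * Y. *)
Definition almost_w_usc_on {R : realType} {X : topologicalType}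
    {E : topologicalLmodType R} {Y : set E} (W : set X) (D : set Y)
    (T : X -> set Y) : Prop :=
  almost_w_usc D (fun x : W => T (set_val x)).

Definition fuzzy_set (R : realType) (Y : Type) : Type := Y -> {i01 R}.

Definition cut {R : realType} {Y : Type} (q : R) (A : fuzzy_set R Y)
  : set Y := [set y | q <= (A y)%:num].

(* [prod_topology X] is the product of the X i, with the product topology. *)
Record fuzzy_economy (R : realType) (I : Type) (X : I -> topologicalType)
    : Type := FuzzyEconomy {
  agents_nonempty : inhabited I ;
  actions_nonempty : forall i, inhabited (X i) ;
  fuzzyA : forall i, prod_topology X -> fuzzy_set R (X i) ;
  fuzzyB : forall i, prod_topology X -> fuzzy_set R (X i) ;
  fuzzyP : forall i, prod_topology X -> fuzzy_set R (X i) ;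
  levela : I -> prod_topology X -> {itv R & `]0, 1]} ;
  levelb : I -> prod_topology X -> {itv R & `]0, 1]} ;
  levelp : I -> prod_topology X -> {itv R & `]0, 1]} }.

Section economy.
Context {R : realType} {I : Type} {X : I -> topologicalType}.
Variable G : fuzzy_economy R X.

Definition cutA (i : I) (x : prod_topology X) : set (X i) :=
  cut (levela G i x)%:num (fuzzyA G i x).

Definition cutB (i : I) (x : prod_topology X) : set (X i) :=
  cut (levelb G i x)%:num (fuzzyB G i x).

Definition cutP (i : I) (x : prod_topology X) : set (X i) :=
  cut (levelp G i x)%:num (fuzzyP G i x).

Definition cutAP (i : I) (x : prod_topology X) : set (X i) :=
  cutA i x `&` cutP i x.

Definition fuzzy_equilibrium (x : prod_topology X) : Prop :=
  forall i, closure_corr (cutB i) x (x i) /\ cutA i x `&` cutP i x = set0.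

End economy.

(* Each set X i of E i as a topological space, with the subset topology. *)
Definition subspaces {R : realType} {I : Type} {E : I -> tvsType R}
    (X : forall i, set (E i)) : I -> topologicalType :=
  fun i => (set_type (X i) : topologicalType).

(* Main.v *)
Require Import Defs.
From mathcomp Require Import all_boot all_order all_algebra.
From mathcomp Require Import interval_inference.
From mathcomp Require Import boolp classical_sets functions reals topology.
From mathcomp Require Import convex tvs.
From mathcomp Require Import normedtype zify ring lra.

Set Implicit Arguments.
Unset Strict Implicit.
Unset Printing Implicit Defensive.

Import Order.TTheory GRing.Theory Num.Theory.
Import numFieldTopology.Exports numFieldNormedType.Exports.

(** For each agent i fix a convex symmetric neighborhood V i of 0, and let
    T i x be the value at x of the closed enlargement of the constraint, or,
    when x lies in W i, of the closed enlargement of A i /\ P i.  As W i is open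
    and A i /\ P i is contained in B i, the graph of T i is closed; its values
    are nonempty, convex and contained in the compact convex set D i.  The
    Kakutani-Fan-Glicksberg theorem for products ([product_fixed_point]) yields
    x in the product of the D i with x i in T i x for every i.  These fixed
    points form nonempty closed sets that decrease with V, so by compactness
    one point x belongs to all of them.  Letting V i shrink to 0
    ([closure_enlarge_limit]), x i belongs to the closure of B i at x, and also
    to the closure of A i /\ P i at x if x lies in W i.  The irreflexivity
    hypothesis excludes the latter, hence A i x /\ P i x is empty.

    The fixed point theorem is derived from a combinatorial lemma in the
    following way.  Cover the product of the D i by finitely many small
    neighborhoods of points p 0, ..., p n.  A point l of the n-simplex gives
    x(l), the combination of the p j with weights l j.  Label l by j when p j is
    close to T (x(l)): some label always applies, and the set of points with a
    given label can be made closed.  By [simplex_labelling] some l has every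
    label j with l j <> 0.  Then x(l) is a convex combination of points close to
    the convex set T (x(l)), so it is itself close to it
    ([approximate_fixed_point]), and compactness turns approximate fixed points
    into a fixed point.  This bypasses both Brouwer's theorem and continuous
    selections.

    The labelling lemma is the limit, over finer and finer grids, of a
    discrete statement, [grid_labelling], which is an instance of Scarf's
    lemma on finite sets carrying several linear orders ([scarf]).  The latter
    is a parity argument of Sperner type; it needs no triangulation, because
    its simplices are defined by domination. *)

(** * Scarf's lemma *)

Section combinatorics.
(* Gives the finite sets precedence over the homonymous classical sets. *)
Import mathcomp.boot.fintype mathcomp.boot.finset.

Lemma odd_sum (A : finType) (P : pred A) (F : A -> nat) :
  odd (\sum_(a | P a) F a) = \big[addb/false]_(a | P a) odd (F a).
Proof. exact: (big_morph odd oddD). Qed.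

(** A map that identifies just enough points to lose one value has a single
    nontrivial fiber, made of two points: these are the points that can be
    dropped without changing the image. *)
Lemma card_redundant (A B : finType) (f : A -> B) (S : {set A}) :
  #|S| = #|f @: S|.+1 -> #|[set x in S | f @: (S :\ x) == f @: S]| = 2.
Proof.
move=> cS.
have /imset_injP/= : #|f @: S| != #|S| by rewrite cS neq_ltn ltnSn.
have [/existsP[a /existsP[b /and4P[aS bS ab /eqP fab]]] _|] :=
  boolP [exists a, exists b, [&& a \in S, b \in S, a != b & f a == f b]];
  last first.
  move=> /existsPn nex []; move=> a b aS bS fab; apply/eqP/negP => /negP ab.
  by have /existsPn/(_ b) := nex a; rewrite aS bS ab fab eqxx.
have imD x y : x \in S -> y \in S -> x != y -> f x = f y ->
    f @: (S :\ x) = f @: S.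
  move=> xS yS xy fxy; apply/eqP; rewrite eqEsubset imsetS ?subsetDl//=.
  apply/subsetP => _ /imsetP[z zS ->]; have [->|zx] := eqVneq z x.
    by rewrite fxy imset_f// !inE eq_sym xy.
  by rewrite imset_f// !inE zx.
suff -> : [set x in S | f @: (S :\ x) == f @: S] = [set a; b].
  by rewrite cards2 ab.
apply/setP => x; rewrite !inE; apply/andP/orP.
  move=> [xS /eqP imx].
  have injx : {in S :\ x &, injective f}.
    by apply/imset_injP; rewrite imx; have := cardsD1 x S; rewrite xS; lia.
  have [|ax] := eqVneq x a; first by left.
  have [|bx] := eqVneq x b; first by right.
  by case/eqP: ab; apply: injx; rewrite // !inE eq_sym ?ax ?bx.
case=> /eqP ->; split=> //; apply/eqP; first exact: (imD a b).
by apply: (imD b a); rewrite // eq_sym.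
Qed.

Section scarf.
Variables (T I : finType) (k : I -> T -> nat).
Hypothesis k_inj : forall i, injective (k i).
Implicit Types (S : {set T}) (C : {set I}).

(** For points of a simplex ordered by their coordinates, this says that no
    point is interior to the simplex bounded below, for each coordinate in [C],
    by the least value taken on [S]. *)
Definition dominant S C :=
  [forall y, exists i in C, [forall x in S, k i y <= k i x]].

Lemma dominantP S C :
  reflect (forall y, exists2 i, i \in C & {in S, forall x, k i y <= k i x})
          (dominant S C).
Proof.
apply: (iffP forallP) => [dom y|dom y].
  have /existsP[i /andP[iC /forallP le]] := dom y.
  by exists i => // x xS; have /implyP := le x; exact.
have [i iC le] := dom y; apply/existsP; exists i; rewrite iC/=.
by apply/forallP => x; apply/implyP; exact: le.
Qed.

Lemma dominantS S S' C C' : S' \subset S -> C \subset C' ->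
  dominant S C -> dominant S' C'.
Proof.
move=> /subsetP SS /subsetP CC /dominantP dom; apply/dominantP => y.
by have [i /CC iC le] := dom y; exists i => // x /SS; exact: le.
Qed.

(** Rooms play the role of the full simplices of a triangulation and doors, the
    dominant pairs with one more order than points, that of their facets.
    Passing from a room to a door removes a point or adds an order. *)
Definition room (r : {set T} * {set I}) :=
  dominant r.1 r.2 && (#|r.1| == #|r.2|).

Definition adjacent (d r : {set T} * {set I}) :=
  (d.1 \subset r.1) && (r.2 \subset d.2).

Section minima.
Variables (x0 : T).

(** The least element of [S] for the i-th order; the default value [x0] only
    serves for the empty set. *)
Definition argm S i := [arg min_(x < odflt x0 [pick z in S] in S) k i x].

Lemma argmP S i : S != set0 ->
  argm S i \in S /\ {in S, forall z, k i (argm S i) <= k i z}.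
Proof.
move=> S0; rewrite /argm; case: arg_minnP => [|x xS le].
  by case: pickP => //= S_; case/set0Pn: S0 => z; rewrite S_.
by split=> // z zS; exact: le.
Qed.

Lemma argm_eq S i x : x \in S -> {in S, forall z, k i x <= k i z} ->
  argm S i = x.
Proof.
move=> xS le; have S0 : S != set0 by apply/set0Pn; exists x.
have [mS mle] := argmP i S0; apply: (@k_inj i); apply/eqP.
by rewrite eqn_leq mle// le.
Qed.

(** Domination applied to a point of [S] says that it is the minimum of [S] for
    some order. *)
Lemma argm_surj S C : S != set0 -> dominant S C -> argm S @: C = S.
Proof.
move=> S0 /dominantP dom; apply/eqP; rewrite eqEsubset; apply/andP; split.
  by apply/subsetP => _ /imsetP[i iC ->]; have [] := argmP i S0.
apply/subsetP => x xS; have [i iC le] := dom x.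
by apply/imsetP; exists i => //; rewrite (argm_eq xS).
Qed.

Lemma room_neq0 r : room r -> r.1 != set0.
Proof.
move=> /andP[/dominantP/(_ x0)[i ir _] /eqP cr]; apply: contraTneq ir => r0.
move: cr; rewrite r0 cards0 => /esym/eqP; rewrite cards_eq0 => /eqP ->.
by rewrite inE.
Qed.

Lemma argm_inj r : room r -> {in r.2 &, injective (argm r.1)}.
Proof.
move=> Rr; have r0 := room_neq0 Rr; case/andP: Rr => dr /eqP cr.
by apply/imset_injP; rewrite argm_surj// cr.
Qed.

Section pivoting.
Variables (S : {set T}) (D : {set I}).
Hypothesis cardSD : #|D| = #|S|.+1.

Lemma adjacentP r : room r -> adjacent (S, D) r ->
  (exists2 j, j \in D & r = (S, D :\ j)) \/
  (exists2 y, y \notin S & r = (y |: S, D)).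
Proof.
case: r => A C /andP[/= _ /eqP cAC] /andP[/= SA CD].
have [AS|AS] := eqVneq A S.
  have /cards1P[j DCj] : #|D :\: C| == 1.
    by rewrite cardsDS//; apply/eqP; move: cAC; rewrite AS; lia.
  have /setDP[jD _] : j \in D :\: C by rewrite DCj inE.
  left; exists j => //.
  by rewrite AS -DCj setDDr setDv set0U; move/setIidPr: CD => ->.
have SpA : #|S| < #|A| by rewrite proper_card// properEneq eq_sym AS.
have CD' : C = D by apply/eqP; rewrite eqEcard CD; lia.
have /cards1P[y ASy] : #|A :\: S| == 1.
  by rewrite cardsDS//; apply/eqP; move: cAC; rewrite CD'; lia.
have /setDP[_ yS] : y \in A :\: S by rewrite ASy inE.
right; exists y => //.
by rewrite CD' -ASy setDE setUC setUIr setUCr setIT; move/setUidPr: SA => ->.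
Qed.

(** The orders of the door that can be given up while every point of [S]
    remains a minimum: each of them leads to exactly one adjacent room. *)
Definition pivots := [set j in D | argm S @: (D :\ j) == S].

Lemma card_pivots0 : S = set0 -> #|pivots| = 1.
Proof.
move=> S0; suff -> : pivots = D by rewrite cardSD S0 cards0.
apply/setP => j; rewrite inE; case: (boolP (j \in D)) => //= jD.
suff -> : D :\ j = set0 by rewrite imset0 S0 eqxx.
apply/eqP; rewrite -cards_eq0; have := cardsD1 j D.
by rewrite jD cardSD S0 cards0; lia.
Qed.

Hypothesis domSD : dominant S D.

(** There is one more order than points, so that exactly two orders share
    their minimum. *)
Lemma card_pivots : S != set0 -> #|pivots| = 2.
Proof.
move=> S0; have aS := argm_surj S0 domSD.
by rewrite -[RHS](@card_redundant _ _ (argm S) D) ?aS.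
Qed.

(** The pivot that leads from the door [(S, D)] to the adjacent room [r]: the
    order that [r] gave up, or the one whose minimum in [r] is the new point. *)
Definition associated (r : {set T} * {set I}) j :=
  ~~ ((j \in r.2) && (argm r.1 j \in S)).

Lemma associated_remove j j' : room (S, D :\ j) -> j' \in D ->
  associated (S, D :\ j) j' = (j' == j).
Proof.
move=> /room_neq0/= S0 jD; have [aS _] := argmP j' S0.
by rewrite /associated/= !inE jD aS !andbT negbK.
Qed.

Lemma associated_add y j : y \notin S -> room (y |: S, D) -> j \in D ->
  associated (y |: S, D) j = (argm (y |: S) j == y).
Proof.
move=> yS /room_neq0/= S0 jD; have [+ _] := argmP j S0.
rewrite /associated/= jD !inE; case: eqVneq => [->|_ /= ->//].
by rewrite (negPf yS).
Qed.

Lemma room_pivot r : room r -> adjacent (S, D) r ->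
  #|[set j in pivots | associated r j]| = 1.
Proof.
move=> Rr /(adjacentP Rr)[[j jD rE]|[y yS rE]]; move: Rr; rewrite {}rE => Rr.
  suff -> : [set j0 in pivots | associated (S, D :\ j) j0] = [set j].
    by rewrite cards1.
  apply/setP => i; rewrite !inE.
  have [iD|iD] := boolP (i \in D); last first.
    by rewrite andFb; apply/esym; apply: contraNF iD => /eqP ->.
  rewrite associated_remove// andbC; case: (eqVneq i j) => [->|//] /=.
  have /= S0 := room_neq0 Rr; case/andP: Rr => /= dr _.
  by rewrite argm_surj ?eqxx.
have /= S0 := room_neq0 Rr; have /= inj := argm_inj Rr.
have sur : argm (y |: S) @: D = y |: S by apply: argm_surj => //; case/andP: Rr.
have /imsetP[j jD yE] : y \in argm (y |: S) @: D by rewrite sur setU11.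
suff -> : [set j0 in pivots | associated (y |: S, D) j0] = [set j].
  by rewrite cards1.
apply/setP => i; rewrite !inE.
have [iD|iD] := boolP (i \in D); last first.
  by rewrite andFb; apply/esym; apply: contraNF iD => /eqP ->.
have -> : associated (y |: S, D) i = (i == j).
  rewrite associated_add//; apply/eqP/eqP => [ai|->//].
  by apply: inj; rewrite // ai.
rewrite andbC; case: (eqVneq i j) => [->|//] /=.
have old i' : i' \in D -> i' != j -> argm S i' = argm (y |: S) i'.
  move=> iD' ij; have [mS mle] := argmP i' S0.
  apply: argm_eq; last by move=> z zS; apply: mle; rewrite !inE zS orbT.
  move: mS; rewrite !inE; case: eqVneq => [my|_]//=.
  by case/eqP: ij; apply: inj; rewrite // -yE.
apply/eqP/setP => x; apply/imsetP/idP.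
  case=> i'; rewrite !inE => /andP[ij iD'] ->; rewrite old//.
  have [+ _] := argmP i' S0; rewrite !inE.
  case: eqVneq => [my|_]//=.
  by case/eqP: ij; apply: inj; rewrite // -yE.
move=> xS; have : x \in argm (y |: S) @: D by rewrite sur !inE xS orbT.
case/imsetP => i' iD' xE; have ij : i' != j.
  by apply: contraNneq yS => ij; rewrite yE -ij -xE.
by exists i'; rewrite ?inE ?ij ?old.
Qed.

(** If the order [j] can be given up without losing domination, doing so gives
    the room.  Otherwise some points are above the minimum of [S] for each of
    the remaining orders, and the room is obtained by adding the one among them
    that is highest for [j]. *)
Lemma pivot_room j : j \in pivots ->
  #|[set r | room r && adjacent (S, D) r && associated r j]| = 1.
Proof.
rewrite inE => /andP[jD /eqP Sj]; apply/eqP/cards1P.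
have cDj : #|D :\ j| = #|S| by have := cardsD1 j D; rewrite jD; lia.
have [domj|] := boolP (dominant S (D :\ j)).
  have Rr : room (S, D :\ j) by rewrite /room domj cDj /=.
  exists (S, D :\ j); apply/setP => r; rewrite !inE; apply/idP/eqP; last first.
    move=> ->; rewrite Rr/= associated_remove// eqxx andbT.
    by rewrite /adjacent/= subxx subD1set.
  move=> /andP[/andP[Rr' /(adjacentP Rr')[[i iD rE]|[y yS rE]]]];
    move: Rr'; rewrite {r}rE => Rr'.
    by rewrite associated_remove// => /eqP ->.
  rewrite associated_add// => /eqP ay.
  move/dominantP: domj => /(_ y)[i]; rewrite !inE => /andP[ij iD] le.
  have ayi : argm (y |: S) i = y.
    by apply: argm_eq => [|z]; rewrite !inE ?eqxx// => /orP[/eqP ->|/le].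
  by case/eqP: ij; apply: (argm_inj Rr'); rewrite //= ay ayi.
move=> ndom.
pose M := [pred y | [forall i in D :\ j, exists x in S, k i x < k i y]].
have MP y : reflect
    (forall i, i \in D -> i != j -> exists2 x, x \in S & k i x < k i y) (M y).
  apply: (iffP forallP) => [My i iD ij|My i].
    have := My i; rewrite !inE iD ij/= => /existsP[x /andP[xS lt]].
    by exists x.
  apply/implyP; rewrite !inE => /andP[ij iD]; have [x xS lt] := My i iD ij.
  by apply/existsP; exists x; rewrite xS.
have [y0 My0] : exists y, M y.
  move: ndom; rewrite negb_forall => /existsP[y].
  rewrite negb_exists => /forallP le.
  exists y; apply/MP => i iD ij; have := le i; rewrite !inE ij iD/=.
  rewrite negb_forall => /existsP[x].
  by rewrite negb_imply -ltnNge => /andP[xS lt]; exists x.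
case: (@arg_maxnP _ y0 M (k j) My0) => y /MP My ymax.
have Mj z : M z -> {in S, forall x, k j z <= k j x}.
  move=> /MP Mz; have /dominantP/(_ z)[i iD le] := domSD.
  have [<-//|ij] := eqVneq i j.
  by have [x /le xS] := Mz i iD ij; rewrite ltnNge xS.
have yS : y \notin S.
  apply/negP; rewrite -Sj => /imsetP[i]; rewrite !inE => /andP[ij iD] yE.
  have [x xS] := My i iD ij; rewrite ltnNge {1}yE.
  have S0 : S != set0 by apply/set0Pn; exists x.
  by have [_ ->] := argmP i S0.
have Rr : room (y |: S, D).
  rewrite /room/= cardsU1 yS cardSD eqxx andbT; apply/dominantP => z.
  have [Mz|] := boolP (M z).
    exists j => // x; rewrite !inE => /orP[/eqP ->|]; first exact: ymax.
    exact: Mj.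
  move=> /forallPn[i]; rewrite negb_imply !inE => /andP[/andP[ij iD]].
  rewrite negb_exists => /forallP le; exists i => //.
  have leS : {in S, forall x, k i z <= k i x}.
    by move=> x xS; have := le x; rewrite xS/= -leqNgt.
  move=> x; rewrite !inE => /orP[/eqP ->|/leS//].
  by have [x' /leS zx' /ltnW] := My i iD ij; exact: leq_trans.
have ay : argm (y |: S) j = y.
  apply: argm_eq => [|z]; rewrite !inE ?eqxx// => /orP[/eqP ->//|].
  by apply: Mj; apply/MP.
exists (y |: S, D); apply/setP => r; rewrite !inE; apply/idP/eqP; last first.
  move=> ->; rewrite Rr/= associated_add// ay eqxx andbT.
  by rewrite /adjacent/= subxx subsetUr.
move=> /andP[/andP[Rr' /(adjacentP Rr')[[i iD rE]|[z zS rE]]]];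
  move: Rr'; rewrite {r}rE => Rr'.
  rewrite associated_remove// => /eqP ji; move: ndom.
  by rewrite ji; case/andP: Rr' => /= ->.
rewrite associated_add// => /eqP az.
have /= zS0 := room_neq0 Rr'.
have Mz : M z.
  apply/MP => i iD ij; have [aiS aile] := argmP i zS0.
  have aiz : argm (z |: S) i != z.
    apply: contraNneq ij => aiz.
    by apply/eqP; apply: (argm_inj Rr'); rewrite //= aiz az.
  exists (argm (z |: S) i); first by move: aiS; rewrite !inE (negPf aiz).
  rewrite ltn_neqAle aile ?setU11// andbT; apply: contraNneq aiz => /k_inj.
  by move=> ->.
have /andP[/dominantP/(_ y)[i iD le] _] := Rr'.
have [ij|ij] := eqVneq i j; last first.
  by have [x xS] := My i iD ij; rewrite ltnNge le// !inE xS orbT.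
suff -> : z = y by [].
apply: (@k_inj j); apply/eqP; rewrite eqn_leq; apply/andP; split.
  exact: ymax.
by rewrite -ij le// setU11.
Qed.

(** Each adjacent room is associated with one pivot, and each pivot with one
    adjacent room. *)
Lemma card_rooms : #|[set r | room r && adjacent (S, D) r]| = #|pivots|.
Proof.
rewrite -!sum1_card.
under eq_bigr => r.
  rewrite inE => /andP[Rr ar]; rewrite -(room_pivot Rr ar) -sum1_card.
  under eq_bigl do rewrite inE.
  over.
under [RHS]eq_bigr => j jp.
  rewrite -(pivot_room jp) -sum1_card.
  under eq_bigl do rewrite inE.
  over.
rewrite /= (exchange_big_dep (mem pivots))/=; last by move=> r j _ /andP[].
apply: eq_bigr => j jp; apply: eq_bigl => r.
by rewrite inE jp.
Qed.

End pivoting.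
End minima.

Section coloring.
Variables (i0 : I) (c : T -> I).

(** The doors that count in the parity argument: those whose points carry all
    the colors of the door but [i0]. *)
Definition door (d : {set T} * {set I}) :=
  [&& dominant d.1 d.2, #|d.2| == #|d.1|.+1, i0 \in d.2
    & c @: d.1 == d.2 :\ i0].

(** A room with such a door that is not fully colored has exactly two of them:
    either two points share a color and each can be removed, or one point has a
    color [j] outside the room, and either this point can be removed or the
    order [j] added. *)
Lemma even_doors r : room r -> c @: r.1 != r.2 ->
  ~~ odd #|[set d | door d && adjacent d r]|.
Proof.
move=> Rr; case: r Rr => A C Rr /= cAC; have /andP[/= domAC /eqP cardAC] := Rr.
have [->|[d]] := set_0Vmem [set d | door d && adjacent d (A, C)].
  by rewrite cards0.
rewrite inE => /andP[]; case: d => S D.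
move=> /and4P[/= domSD /eqP cardSD iD /eqP cS] ad.
have doorP S' D' : door (S', D') -> adjacent (S', D') (A, C) ->
    (S' = A /\ exists2 j, j \in D' & C = D' :\ j) \/
    (D' = C /\ exists2 y, y \notin S' & A = y |: S').
  move=> /and4P[/= dom /eqP card _ _] /(adjacentP card Rr).
  case=> [[j jD [-> ->]]|[y yS [-> ->]]]; [left|right]; split=> //.
    by exists j.
  by exists y.
have iC : i0 \in C.
  have dSD : door (S, D) by rewrite /door/= domSD cardSD iD cS !eqxx.
  have [[SA [j jD CE]]|[<-//]] := doorP _ _ dSD ad.
  have [ij|ij] := eqVneq i0 j; last by rewrite CE !inE ij.
  by case/eqP: cAC; rewrite CE -ij -cS SA.
have cCi : #|C| = #|C :\ i0|.+1 by rewrite (cardsD1 i0) iC.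
have CcA : C :\ i0 \subset c @: A.
  case/andP: ad => /= SA CD.
  by apply: subset_trans (imsetS c SA); rewrite cS setSD.
have adR x : x \in A -> adjacent (A :\ x, C) (A, C).
  by move=> xA; rewrite /adjacent/= subD1set subxx.
have domR x : dominant (A :\ x) C by apply: dominantS domAC; rewrite ?subD1set.
have cardR x : x \in A -> #|C| = #|A :\ x|.+1.
  by move=> xA; rewrite -cardAC (cardsD1 x A) xA.
have [cA|cA] := eqVneq (c @: A) (C :\ i0).
  have fib : #|A| = #|c @: A|.+1 by rewrite cA cardAC.
  suff -> : [set d | door d && adjacent d (A, C)] =
      [set (A :\ x, C) | x in [set x in A | c @: (A :\ x) == c @: A]].
    rewrite card_in_imset ?card_redundant// => x y; rewrite !inE.
    move=> /andP[xA _] /andP[yA _] [] Axy; apply/eqP.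
    by have := setD11 x A; rewrite Axy !inE xA andbT => /negbFE.
  apply/setP => -[S' D']; rewrite inE; apply/andP/imsetP.
    move=> [dr ar]; have /and4P[/= _ /eqP card iD' /eqP cS'] := dr.
    have [[SA [j jD CE]]|[CD [y yS AE]]] := doorP _ _ dr ar.
      move: cCi; rewrite -cA -SA cS' CE => cc.
      by move: (cardsD1 i0 D') (cardsD1 j D') cc; rewrite iD' jD; clear; lia.
    have SE : S' = A :\ y by rewrite AE setU1K.
    exists y; rewrite -?SE ?CD// !inE {1}AE setU11/=.
    by rewrite -SE cS' CD cA.
  case=> x; rewrite !inE => /andP[xA /eqP cAx] [-> ->]; split; last exact: adR.
  by rewrite /door/= domR cAx cA iC eqxx -cardR// eqxx.
have ltcA : #|C :\ i0| < #|c @: A|.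
  by apply: proper_card; rewrite properEneq eq_sym cA.
have lecA := leq_imset_card c A.
have ccA : #|c @: A| = #|A| by lia.
have injc : {in A &, injective c} by apply/imset_injP; rewrite ccA.
have /cards1P[j jE] : #|c @: A :\: (C :\ i0)| == 1.
  by rewrite cardsDS//; apply/eqP; lia.
have /setDP[jA jC] : j \in c @: A :\: (C :\ i0) by rewrite jE inE.
have cAE : c @: A = j |: (C :\ i0).
  by rewrite -jE setDE setUC setUIr setUCr setIT; apply/esym/setUidPr.
have jnC : j \notin C.
  apply: contraNN cAC => jC'; move: jC; rewrite !inE jC' andbT negbK => /eqP ji.
  by rewrite cAE ji setD1K.
have ji : i0 != j by apply: contraNneq jnC => <-.
have /imsetP[x xA xj] := jA.
have cAx : c @: (A :\ x) = C :\ i0.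
  apply/setP => i; apply/imsetP/idP => [[y]|iCi].
    rewrite !inE => /andP[yx yA] iE.
    have : i \in c @: A by rewrite iE imset_f.
    rewrite cAE !inE => /orP[/eqP ij|//]; case/eqP: yx; apply: injc => //.
    by rewrite -iE ij.
  have /imsetP[y yA iE] := subsetP CcA _ iCi.
  exists y => //; rewrite !inE yA andbT.
  by apply: contraNneq jC => yx; rewrite xj -yx -iE.
suff -> : [set d | door d && adjacent d (A, C)] =
    [set (A :\ x, C); (A, j |: C)].
  rewrite cards2; suff -> : (A :\ x, C) != (A, j |: C) by [].
  by apply/eqP => -[Ax _]; move: (setD11 x A); rewrite Ax xA.
apply/setP => -[S' D']; rewrite !inE; apply/andP/orP.
  move=> [dr ar]; have /and4P[/= _ /eqP card iD' /eqP cS'] := dr.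
  have [[SA [i iD'' CE]]|[CD [y yS AE]]] := doorP _ _ dr ar.
    right; rewrite SA; suff -> : j = i by rewrite CE setD1K.
    have : j \in D' :\ i0 by rewrite -cS' SA.
    rewrite !inE => /andP[_ jD']; apply/eqP; apply: contraNT jnC => ij.
    by rewrite CE !inE ij.
  left; rewrite CD; suff yx : y = x by rewrite -yx AE setU1K.
  apply: injc => //; first by rewrite AE setU11.
  rewrite -xj; move: jA; rewrite {1}AE imsetU1 cS' CD in_setU1 (negPf jC) orbF.
  by move/eqP.
case=> /eqP[-> ->]; split; last 1 first.
- by rewrite /adjacent/= subxx subsetUr.
- by rewrite /door/= domR cAx iC eqxx -cardR// eqxx.
- exact: adR.
rewrite /door/=; apply/and4P; split.
- by apply: dominantS domAC => //; exact: subsetUr.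
- by rewrite cardsU1 jnC -cardAC.
- by rewrite !inE iC orbT.
- rewrite cAE; apply/eqP/setP => i; rewrite !inE.
  by case: eqVneq => [->|_]//=; rewrite eq_sym ji.
Qed.

(** Count the adjacent pairs of a door and a room modulo 2.  Every door is
    adjacent to two rooms, except the door without points, which is adjacent to
    one; so some room is adjacent to an odd number of doors, and it is fully
    colored. *)
Theorem scarf (x0 : T) : exists2 r, room r & c @: r.1 = r.2.
Proof.
have [/existsP[r /andP[Rr /eqP cr]]|none] :=
  boolP [exists r, room r && (c @: r.1 == r.2)]; first by exists r.
pose N := \sum_(d | door d) #|[set r | room r && adjacent d r]|.
have : N = \sum_(r | room r) #|[set d | door d && adjacent d r]|.
  rewrite /N; under eq_bigr do rewrite -sum1_card.
  under [RHS]eq_bigr do rewrite -sum1_card.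
  rewrite (exchange_big_dep room)/=; last first.
    by move=> d r _; rewrite inE => /andP[].
  by apply: eq_bigr => r Rr; apply: eq_bigl => d; rewrite !inE Rr.
move/(congr1 odd); rewrite !odd_sum [RHS]big1; last first.
  move=> r Rr; apply/negbTE/even_doors => //; apply: contraNN none => cr.
  by apply/existsP; exists r; rewrite Rr.
have outside : door (set0, [set i0]).
  apply/and4P; split=> /=; rewrite ?cards1 ?cards0 ?inE//.
    by apply/dominantP => y; exists i0 => [|x]; rewrite inE.
  by rewrite imset0 setDv.
rewrite (bigD1 _ outside) big1 /=.
  have /and4P[/= dom /eqP card _ _] := outside.
  by rewrite (card_rooms x0 card dom) (card_pivots0 x0 card).
move=> [S D] /andP[dSD neq]; have /and4P[/= dom /eqP card iD _] := dSD.
rewrite (card_rooms x0 card dom) card_pivots//; apply: contraNneq neq => S0.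
by rewrite S0 xpair_eqE eqxx eq_sym eqEcard sub1set iD card S0 cards0 cards1.
Qed.

End coloring.
End scarf.

(* The points with coordinates multiple of 1/N of the standard simplex, scaled
   by N.  The i-th order is that of the i-th coordinate, refined to a linear
   order by an arbitrary enumeration. *)
Section grid.
Variables (n N : nat).
Implicit Types g : {ffun 'I_n.+1 -> 'I_N.+1}.

Let grid := {g : {ffun 'I_n.+1 -> 'I_N.+1} | \sum_i (g i : nat) == N}.

Let key (i : 'I_n.+1) (g : grid) : nat := val g i * #|{: grid}| + enum_rank g.

Let key_inj i : injective (key i).
Proof.
move=> g h /(congr1 (modn^~ #|{: grid}|)).
by rewrite /key !modnMDl !modn_small// => /ord_inj/enum_rank_inj.
Qed.

Let ltn_key i (g h : grid) : val g i < val h i -> key i g < key i h.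
Proof.
move=> gh; rewrite /key; apply: (@leq_trans (val h i * #|{: grid}|)).
  apply: (@leq_trans ((val g i).+1 * #|{: grid}|)); last first.
    by rewrite leq_mul2r gh orbT.
  by rewrite mulSnr -addnS leq_add2l ltn_ord.
exact: leq_addr.
Qed.

Lemma grid_of_sum (v : 'I_n.+1 -> nat) : \sum_i v i = N ->
  exists g : grid, forall i, val g i = v i :> nat.
Proof.
move=> vN; have vi i : v i < N.+1 by rewrite ltnS -vN (bigD1 i)//= leq_addr.
have gN : \sum_i ([ffun i => Ordinal (vi i)] i : nat) == N.
  by apply/eqP; rewrite -[RHS]vN; apply: eq_bigr => i _; rewrite ffunE.
by exists (Sub [ffun i => Ordinal (vi i)] gN) => i; rewrite /= ffunE.
Qed.

(** Let [m i] be the least i-th coordinate in the fully colored room [(S, C)].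
    The sum of the [m i] over [C] is close to [N]: otherwise, increasing these
    coordinates by one would give a grid point above the minimum of [S] for
    every order in [C], contradicting domination.  Hence the points of [S] are
    close to each other, and their coordinates outside [C] are small. *)
Lemma grid_labelling (c : {ffun 'I_n.+1 -> 'I_N.+1} -> 'I_n.+1) :
  exists g, \sum_i (g i : nat) = N /\ forall j, g j <= n.+1 \/
    exists g', [/\ \sum_i (g' i : nat) = N, c g' = j &
      forall i, g i <= g' i + n.+1 /\ g' i <= g i + n.+1].
Proof.
have [x0 _] : exists g : grid,
    forall i, val g i = (if i == ord0 then N else 0) :> nat.
  by apply: grid_of_sum; rewrite -big_mkcond big_pred1_eq.
have [[S C] Rr cS] := scarf key_inj ord0 (fun x : grid => c (val x)) x0.
have /set0Pn[x1 x1S] := room_neq0 x0 Rr.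
case/andP: Rr => /= /dominantP dom _; rewrite /= in x1S cS.
have sumT (x : grid) : \sum_i (val x i : nat) = N by apply/eqP; exact: (valP x).
pose a i := [arg min_(x < x1 in S) (val x i : nat)].
have aS i : a i \in S by rewrite /a; case: arg_minnP.
have amin i x : x \in S -> val (a i) i <= val x i.
  by move=> xS; rewrite /a; case: arg_minnP => // y _; exact.
pose m i : nat := val (a i) i.
have CE : #|C| <= n.+1 by rewrite -[leqRHS]card_ord max_card.
have sumM : N < \sum_(i in C) m i + #|C|.
  have [i1 i1C] : exists i1, i1 \in C by have [i iC _] := dom x0; exists i.
  rewrite ltnNge; apply/negP; rewrite -sum1_card -big_split/=.
  rewrite (bigD1 i1)//=; set rest := (X in _ + X) => leN.
  pose v i := if i == i1 then N - rest else if i \in C then m i + 1 else 0.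
  have [|y yv] := @grid_of_sum v.
    rewrite (bigD1 i1)//= {1}/v eqxx.
    rewrite [X in _ + X](_ : _ = rest); first by rewrite subnK//; lia.
    rewrite /rest big_mkcondl; apply: eq_bigr => i ii1; rewrite /v (negPf ii1).
    by [].
  have [i iC le] := dom y.
  have := le _ (aS i); rewrite leqNgt ltn_key// yv -/(m i) /v iC.
  by case: (eqVneq i i1) => [->|_]; lia.
have sumx (x : grid) : x \in S ->
    forall i, val x i <= (if i \in C then m i else 0) + n.+1.
  move=> xS i.
  pose X j : nat := val x j.
  have sX : \sum_(j in C) X j + \sum_(j | j \notin C) X j = N.
    by rewrite -[RHS](sumT x) [RHS](bigID (fun j => j \in C)).
  have le Q : \sum_(j in C | Q j) m j <= \sum_(j in C | Q j) X j.
    by apply: leq_sum => j _; exact: amin.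
  rewrite -/(X i); case: ifPn => iC.
    have eM : \sum_(j in C) m j = m i + \sum_(j in C | j != i) m j.
      by rewrite (bigD1 i).
    have eX : \sum_(j in C) X j = X i + \sum_(j in C | j != i) X j.
      by rewrite (bigD1 i).
    by have := le (fun j => j != i); lia.
  have eX : \sum_(j | j \notin C) X j =
      X i + \sum_(j | (j \notin C) && (j != i)) X j by rewrite (bigD1 i).
  have : \sum_(j in C) m j <= \sum_(j in C) X j.
    by apply: leq_sum => j _; exact: amin.
  by lia.
exists (val x1); split=> // j; have [jC|jC] := boolP (j \in C); last first.
  by left; have := sumx _ x1S j; rewrite (negPf jC).
right; move: jC; rewrite -cS => /imsetP[x2 x2S jE].
exists (val x2); split=> // i.
have := amin i _ x1S; have := amin i _ x2S; rewrite -/(m i).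
have := sumx _ x1S i; have := sumx _ x2S i.
move: (val x1 i : nat) (val x2 i : nat) => u w.
by case: ifP => _; lia.
Qed.

End grid.

End combinatorics.

Local Open Scope classical_set_scope.
Local Open Scope ring_scope.

(** * Closed coverings of the simplex *)

Definition simplex (R : realType) n : set 'rV[R]_n :=
  [set l | (forall j, 0 <= l ord0 j) /\ \sum_j l ord0 j = 1].

Lemma compact_directed (T : topologicalType) (J : Type) (K : set T)
    (Q : J -> set T) : compact K -> inhabited J ->
  (forall j, K `&` Q j !=set0) ->
  (forall i j, exists k, Q k `<=` Q i `&` Q j) ->
  exists2 x, K x & forall j, closure (Q j) x.
Proof.
move=> cK [j0] Q0 dir.
pose F : set_system T := filter_from setT (fun j => K `&` Q j).
have FF : ProperFilter F.
  apply: filter_from_proper; last by move=> j _; exact: Q0.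
  apply: filter_from_filter; first by exists j0.
  move=> i j _ _; have [k sub] := dir i j; exists k => //.
  by move=> x [Kx /sub[]].
have [x [Kx clx]] : K `&` cluster F !=set0.
  by apply: cK; exists j0 => // x [].
exists x => // j B xB; have [|z [[_ Qz] Bz]] := clx (K `&` Q j) B _ xB.
  by exists j.
by exists z.
Qed.

Section labelling.
Context {R : realType} {n : nat}.

Lemma simplex_entry_le1 (l : 'rV[R]_n) j : simplex l -> l ord0 j <= 1.
Proof.
move=> [l0 l1]; rewrite -l1 (bigD1 j)//= lerDl.
by apply: sumr_ge0 => i _; exact: l0.
Qed.

Lemma simplex_compact : compact (@simplex R n).
Proof.
apply: (@subclosed_compact _ _
  [set v : 'rV[R]_n | forall i, `[0, 1]%classic (v ord0 i)]).
- rewrite (_ : @simplex R n =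
    (\bigcap_j ((fun l : 'rV[R]_n => l ord0 j) @^-1` [set x | 0 <= x])) `&`
    ((fun l : 'rV[R]_n => \sum_j l ord0 j) @^-1` [set x | x = 1])); last first.
    rewrite eqEsubset; split=> l [l0 l1]; split=> // j; last exact: l0.
    by move=> _; exact: l0.
  apply: closedI.
    apply: closed_bigI => j _; apply: preimage_closed; last exact: closed_ge.
    by move=> l _; exact: coord_continuous.
  apply: preimage_closed; last exact: closed_eq.
  move=> l _; apply: (@continuous_big R^o) => [|j _].
    exact: add_continuous.
  exact: coord_continuous.
- apply: (@rV_compact R n (fun=> `[0, 1]%classic)) => i.
  exact: segment_compact.
- by move=> l Sl i /=; rewrite in_itv/= Sl.1 simplex_entry_le1.
Qed.
End labelling.

Lemma grid_point (R : realType) n N (g : {ffun 'I_n.+1 -> 'I_N.+2}) :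
  (\sum_i (g i : nat) = N.+1)%N ->
  simplex (\row_i ((g i)%:R / N.+1%:R) : 'rV[R]_n.+1).
Proof.
move=> gN; split=> [j|]; first by rewrite mxE divr_ge0.
under eq_bigr do rewrite mxE.
by rewrite -mulr_suml -natr_sum gN divff.
Qed.

(** A dual form of the Knaster-Kuratowski-Mazurkiewicz lemma.  On the grid of
    mesh 1/N some point is, for each j, within a multiple of 1/N of the face
    where the j-th coordinate vanishes or of [F j]; a limit of such points works
    since the [F j] are closed. *)
Lemma simplex_labelling (R : realType) n (F : 'I_n.+1 -> set 'rV[R]_n.+1) :
  (forall j, closed (F j)) ->
  (forall l, simplex l -> exists j, F j l) ->
  exists2 l, simplex l & forall j, l ord0 j = 0 \/ F j l.
Proof.
move=> Fcl Fcov.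
pose e N : R := n.+1%:R / N.+1%:R.
pose Q N := [set l : 'rV[R]_n.+1 | forall j, l ord0 j <= e N \/
  exists2 l', F j l' & forall i, `|l ord0 i - l' ord0 i| <= e N].
have ele M N : (M <= N)%N -> e N <= e M.
  by move=> MN; rewrite ler_wpM2l// lef_pV2 ?posrE// ler_nat ltnS.
have [||N|M N|l Sl clQ] := @compact_directed _ nat (@simplex R n.+1) Q.
- exact: simplex_compact.
- by constructor; exact: 0%N.
- pose pt (g : {ffun 'I_n.+1 -> 'I_N.+2}) : 'rV[R]_n.+1 :=
    \row_i ((g i)%:R / N.+1%:R).
  have [g [gN near]] :=
    @grid_labelling n N.+1 (fun g => xget ord0 [set j | F j (pt g)]).
  exists (pt g); split; first exact: grid_point.
  move=> j; have [gj|[g' [g'N cg' dist]]] := near j.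
    by left; rewrite mxE ler_wpM2r// ler_nat.
  right; exists (pt g').
    have [i Fi] := Fcov _ (grid_point R g'N).
    by rewrite -cg'; apply: (@xgetPex _ ord0 [set j | F j (pt g')]); exists i.
  move=> i; rewrite !mxE -mulrBl normrM [X in _ * X]ger0_norm// ler_wpM2r//.
  have [] := dist i; rewrite -!(ler_nat R) !natrD => *.
  by rewrite ler_norml; apply/andP; split; lra.
- exists (maxn M N) => l Ql; split=> j; have [lj|[l' Fl' dist]] := Ql j.
  + by left; rewrite (le_trans lj)// ele// leq_maxl.
  + by right; exists l' => // i; rewrite (le_trans (dist i))// ele// leq_maxl.
  + by left; rewrite (le_trans lj)// ele// leq_maxr.
  + by right; exists l' => // i; rewrite (le_trans (dist i))// ele// leq_maxr.
exists l => // j; have [->|lj] := eqVneq (l ord0 j) 0; [by left|right].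
have {}lj : 0 < l ord0 j by rewrite lt_neqAle eq_sym lj Sl.1.
apply: Fcl => B /nbhs_ballP[r /= r0 rB].
pose d := Num.min (l ord0 j) r / 2.
have d0 : 0 < d by rewrite divr_gt0// lt_min lj r0.
have [N eN] : exists N, e N < d.
  have dn0 : 0 < d / n.+1%:R by rewrite divr_gt0.
  have [N _ /(_ N (leqnn _)) /= lt] := near_infty_natSinv_lt (PosNum dn0).
  by exists N; rewrite /e mulrC -ltr_pdivlMr.
have [] := clQ N (ball l d); first exact: nbhsx_ballx.
move=> l1 [Ql1 [_ bl1]].
have dl : d <= l ord0 j / 2 by rewrite ler_pM2r// ge_min lexx.
have dr : d <= r / 2 by rewrite ler_pM2r// ge_min lexx orbT.
have dist i : `|l ord0 i - l1 ord0 i| < d by exact: bl1.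
have [lej|[l' Fl' dist']] := Ql1 j.
  by move: (dist j); rewrite ltr_norml => /andP[_]; lra.
exists l'; split=> //; apply: rB; split=> // i k; rewrite (ord1 i) /ball/=.
rewrite (le_lt_trans (ler_distD (l1 ord0 k) _ _))//.
by have := dist k; have := dist' k; lra.
Qed.

(** * Convexity and compactness *)

Section convexity.
Context {R : realType} {E : lmodType R}.
Implicit Types A B : set E.

Lemma convex_setP A : convex_set A <->
  forall x y (p : R), 0 <= p -> p <= 1 -> A x -> A y ->
    A (p *: x + (1 - p) *: y).
Proof.
split=> [cA x y p p0 p1 Ax Ay|cA x y p /set_mem Ax /set_mem Ay].
  have := cA x y (Itv01 p0 p1) (mem_set Ax) (mem_set Ay).
  by move/set_mem.
by apply/mem_set; apply: cA.
Qed.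

Lemma convex_setI A B : convex_set A -> convex_set B -> convex_set (A `&` B).
Proof.
move=> /convex_setP cA /convex_setP cB; apply/convex_setP => x y p p0 p1.
by move=> [Ax Bx] [Ay By]; split; [exact: cA|exact: cB].
Qed.

Lemma convex_sum A n (l : 'rV[R]_n) (v : 'I_n -> E) : convex_set A ->
  simplex l -> (forall j, l ord0 j != 0 -> A (v j)) ->
  A (\sum_j l ord0 j *: v j).
Proof.
move=> /convex_setP cA [l0 l1] Av; pose w j := l ord0 j.
(* Normalized partial sums stay in [A]. *)
suff H s : 0 < \sum_(j <- s) w j ->
    A ((\sum_(j <- s) w j)^-1 *: \sum_(j <- s) w j *: v j).
  by have := H (index_enum 'I_n); rewrite l1 ltr01 invr1 scale1r; exact.
have ws0 t : 0 <= \sum_(j <- t) w j by apply: sumr_ge0 => j _; exact: l0.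
elim: s => [|i s IH]; first by rewrite big_nil ltxx.
rewrite !big_cons; set W := \sum_(j <- s) w j; set S := \sum_(j <- s) _ => W0.
have [wi|wi] := eqVneq (w i) 0.
  by rewrite wi scale0r !add0r; apply: IH; move: W0; rewrite wi add0r.
have [W'0|W'0] := eqVneq W 0.
  have -> : S = 0.
    rewrite /S big1_seq// => j /= js.
    have /eqP := W'0; rewrite /W psumr_eq0 => [|k _]; last exact: l0.
    by move=> /allP/(_ j js)/eqP ->; rewrite scale0r.
  by rewrite W'0 !addr0 scalerA mulVf// scale1r; exact: Av.
have W'p : 0 < W by rewrite lt_neqAle eq_sym W'0 ws0.
have -> : (w i + W)^-1 *: (w i *: v i + S) =
    (w i / (w i + W)) *: v i + (1 - w i / (w i + W)) *: (W^-1 *: S).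
  rewrite scalerDr !scalerA mulrC; congr (_ + _ *: _).
  by field; rewrite W'0 gt_eqF.
apply: cA; [|by rewrite ler_pdivrMr// mul1r lerDl ltW|exact: Av|exact: IH].
by apply: divr_ge0; [exact: l0|exact: ltW].
Qed.

End convexity.

Section closedness.

Lemma closed_proj (S T : topologicalType) (K : set T) (C : set (S * T)) :
  compact K -> closed C -> closed [set x | exists2 y, K y & C (x, y)].
Proof.
move=> cK cC x clx; apply: contrapT => nx.
have nC : nbhs x [set x' | K `<=` [set y | ~ C (x', y)]].
  move/compact_near_coveringP : cK; apply => y Ky.
  have : nbhs (x, y) (~` C).
    apply: open_nbhs_nbhs; split; first exact: closed_openC.
    by move=> Cxy; apply: nx; exists y.
  move=> [[U V] /= [Ux Vy] UV]; exists (V, U) => // -[y' x'] [/= Vy' Ux'].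
  exact: (UV (x', y')).
by have [x' [[y Ky Cxy] /(_ y Ky)]] := clx _ nC.
Qed.

Lemma closed_eq_fun (S T : topologicalType) (f g : S -> T) :
  hausdorff_space T -> continuous f -> continuous g ->
  closed [set x | f x = g x].
Proof.
move=> hT cf cg x clx; apply: hT => A B fA gB.
have [x' [fg [Ax' Bx']]] :
    [set x | f x = g x] `&` (f @^-1` A `&` g @^-1` B) !=set0.
  by apply: clx; apply: filterI; [exact: cf|exact: cg].
by exists (f x'); split=> //; rewrite fg.
Qed.

Lemma continuous_to_prod (I : Type) (S : topologicalType)
    (T : I -> topologicalType) (f : S -> prod_topology T) :
  (forall i, continuous (fun x => f x i)) -> continuous f.
Proof.
move=> cf x; apply/cvg_sup => i; apply: continuous_comp_initial.
exact: cf.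
Qed.

Lemma continuous_coord (I : Type) (T : I -> topologicalType) (i : I) :
  continuous (fun f : prod_topology T => f i).
Proof. exact: (@proj_continuous {classic I} T i). Qed.

Lemma compact_prod (I : Type) (T : I -> topologicalType)
    (K : forall i, set (T i)) :
  (forall i, compact (K i)) ->
  compact ([set f | forall i, K i (f i)] : set (prod_topology T)).
Proof. exact: (@tychonoff {classic I} T K). Qed.

(** The finitely many points are indexed by a nonempty ordinal, as vertices of a
    simplex. *)
Lemma compact_cover_nbhs (T : topologicalType) (K : set T) (N : T -> set T) :
  compact K -> K !=set0 -> (forall x, K x -> nbhs x (N x)) ->
  exists n (p : 'I_n.+1 -> T), (forall j, K (p j)) /\
    forall x, K x -> exists j, N (p j) x.
Proof.
move=> cK [x0 Kx0] KN.
have [s sK sN] : exists2 s : seq T, {in s, forall p, K p} &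
    forall x, K x -> exists2 p, p \in s & N p x.
  apply: contrapT => nos.
  pose allK (s : seq T) := {in s, forall p, K p}.
  pose Q (s : {s : seq T | allK s}) :=
    [set x | {in sval s, forall p, ~ N p x}].
  have [|[s sK]|[s sK] [t tK]|x Kx clQ] := @compact_directed T _ K Q cK.
  - by constructor; exists nil.
  - apply: contrapT => KQ; apply: nos; exists s => // x Kx.
    apply: contrapT => nx; apply: KQ; exists x; split=> // p ps Npx.
    by apply: nx; exists p.
  - have stK : {in s ++ t, forall p, K p}.
      by move=> p; rewrite mem_cat => /orP[/sK|/tK].
    exists (exist allK _ stK) => x Qx.
    by split=> p ps; apply: Qx; rewrite /= mem_cat ps ?orbT.
  have xK : {in [:: x], forall p, K p} by move=> p; rewrite inE => /eqP ->.
  have [y [Qy Nxy]] := clQ (exist allK _ xK) _ (KN x Kx).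
  by apply: (Qy x) => //=; rewrite inE.
exists (size s); exists (fun j => nth x0 (x0 :: s) j); split.
  by move=> [[|j] /= ltj]//; apply: sK; rewrite mem_nth.
move=> x /sN[p ps Npx].
have ltj : ((index p s).+1 < (size s).+1)%N by rewrite ltnS index_mem.
by exists (Ordinal ltj) => /=; rewrite nth_index.
Qed.

End closedness.

Section tvs.
Context {R : realType} {E : tvsType R}.

Lemma continuous_add (S : topologicalType) (f g : S -> E) :
  continuous f -> continuous g -> continuous (fun x => f x + g x).
Proof.
move=> cf cg x; apply: (@continuous_comp S (E * E)%type E (fun x => (f x, g x))
  (fun z => z.1 + z.2)); last exact: add_continuous.
exact: cvg_pair (cf x) (cg x).
Qed.

Lemma continuous_sub (S : topologicalType) (f g : S -> E) :
  continuous f -> continuous g -> continuous (fun x => f x - g x).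
Proof.
move=> cf cg; apply: continuous_add => // x.
by apply: continuous_comp; [exact: cg|exact: opp_continuous].
Qed.

Lemma continuous_scale (S : topologicalType) (f : S -> R^o) (g : S -> E) :
  continuous f -> continuous g -> continuous (fun x => f x *: g x).
Proof.
move=> cf cg x; apply: (@continuous_comp S (R^o * E)%type E
  (fun x => (f x, g x)) (fun z => z.1 *: z.2)); last exact: scale_continuous.
exact: cvg_pair (cf x) (cg x).
Qed.

Lemma convex_closure (A : set E) : convex_set A -> convex_set (closure A).
Proof.
move=> /convex_setP cA; apply/convex_setP => x y p p0 p1 clx cly B.
pose f (z : E * E) : E := p *: z.1 + (1 - p) *: z.2.
have cf : continuous f.
  apply: continuous_add; apply: continuous_scale => z.
  - exact: cvg_cst.
  - exact: cvg_fst.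
  - exact: cvg_cst.
  - exact: cvg_snd.
move=> /(cf (x, y))[[U V] /= [Ux Vy] UV].
have [x' [Ax' Ux']] := clx _ Ux; have [y' [Ay' Vy']] := cly _ Vy.
by exists (f (x', y')); split; [exact: cA|exact: (UV (x', y'))].
Qed.

(** In a real space, a convex symmetric set containing 0 is balanced: so the
    intersection of a convex neighborhood with its opposite is absolutely
    convex. *)
Lemma abs_convex_nbhs (U : set E) : nbhs 0 U -> exists V : set E,
  [/\ open_nbhs 0 V, absolutely_convex V, symmetric_set V &
    forall a b, V a -> V b -> U (a + b)].
Proof.
move=> U0; have := @add_continuous E (0, 0) U; rewrite /= addr0.
move=> /(_ U0)[[U1 U2] /= [U10 U20] U12].
have [B Bconv [Bop Bbas]] := @locally_convex R E.
have [C [BC C0] CU] := Bbas 0 _ (filterI U10 U20).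
have /convex_setP cC : convex_set C by apply: Bconv; exact/mem_set.
pose V := C `&` (-%R @^-1` C).
have V0 : V 0 by split; rewrite /= ?oppr0.
have sV : symmetric_set V by move=> v [Cv CNv]; split; rewrite /= ?opprK.
have cV : convex_set V.
  apply/convex_setP => x y p p0 p1 [Cx CNx] [Cy CNy]; split; first exact: cC.
  by rewrite /= opprD -!scalerN; exact: cC.
have posV (a : R) v : 0 <= a -> a <= 1 -> V v -> V (a *: v).
  move=> a0 a1 Vv; have /convex_setP/(_ v 0 a a0 a1 Vv V0) := cV.
  by rewrite scaler0 addr0.
exists V; split=> //.
- split=> //; apply: openI; first exact: Bop.
  apply: open_comp; last exact: Bop.
  by move=> v _; exact: opp_continuous.
- split=> // a v a1 Vv; have [a0|a0] := leP 0 a.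
    by apply: posV => //; rewrite -(ger0_norm a0).
  rewrite -[a]opprK scaleNr -scalerN; apply: posV; last exact: sV.
    by rewrite oppr_ge0 ltW.
  by rewrite -(ltr0_norm a0).
- by move=> a b [/CU[Ua _] _] [/CU[_ Ub] _]; exact: (U12 (a, b)).
Qed.

(** The closure of a symmetric neighborhood V of 0 is contained in V + V. *)
Lemma closed_convex_nbhs (U : set E) : nbhs 0 U ->
  exists V : set E, [/\ nbhs 0 V, closed V, convex_set V & V `<=` U].
Proof.
move=> /abs_convex_nbhs[V [[oV V0] [cV _] sV VU]]; exists (closure V); split.
- by apply: filterS (open_nbhs_nbhs (conj oV V0)); exact: subset_closure.
- exact: closed_closure.
- exact: convex_closure.
- move=> x clx; have : nbhs x ((fun z => x - z) @^-1` V).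
    apply: (_ : continuous (fun z : E => x - z)); last first.
      by rewrite /= subrr; exact: open_nbhs_nbhs.
    by apply: continuous_sub => z; [exact: cvg_cst|exact: cvg_id].
  by move=> /clx[z [Vz Vxz]]; rewrite -(subrK z x); exact: VU.
Qed.

End tvs.

(** * The fixed point theorem for products *)

Lemma dependent_choice_fun (I : Type) (A : I -> Type)
    (Q : forall i, A i -> Prop) :
  (forall i, exists x, Q i x) -> exists f : forall i, A i, forall i, Q i (f i).
Proof.
move=> QE; exists (fun i => projT1 (cid (QE i))) => i.
exact: projT2 (cid (QE i)).
Qed.

Section fixed_point.
Context {R : realType} {I : Type} {E : I -> tvsType R}.
Context {X : forall i, set (E i)}.
Arguments X : clear implicits.
Variables (D : forall i, set (X i)).
Arguments D : clear implicits.
Hypotheses (hE : forall i, hausdorff_space (E i))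
  (D0 : forall i, D i !=set0) (cD : forall i, compact (D i))
  (vD : forall i, convex_subset (D i)).

Local Notation P := (prod_topology (subspaces X)).

Definition prodset : set P := [set x | forall i, D i (x i)].

Lemma compact_prodset : compact prodset.
Proof. exact: (@compact_prod I (subspaces X) D). Qed.

Lemma prodset_neq0 : prodset !=set0.
Proof.
have [x Dx] := dependent_choice_fun D0.
by exists x.
Qed.

Lemma continuous_val_coord i : continuous (fun x : P => set_val (x i) : E i).
Proof.
move=> x; apply: (@continuous_comp P (X i) (E i) (fun x : P => x i) set_val).
  exact: (@continuous_coord I (subspaces X)).
exact: initial_continuous.
Qed.

(** Convex combinations are formed coordinatewise in the spaces [E i], as
    [P] itself carries no linear structure. *)
Lemma prodset_mix n (p : 'I_n -> P) (l : 'rV[R]_n) :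
  (forall j, prodset (p j)) -> simplex l ->
  exists2 x, prodset x &
    forall i, set_val (x i) = \sum_j l ord0 j *: set_val (p j i).
Proof.
move=> Dp Sl.
suff /dependent_choice_fun[x Dx] : forall i, exists z, D i z /\
    set_val z = \sum_j l ord0 j *: set_val (p j i).
  by exists x => i; have [] := Dx i.
move=> i.
have [|z Dz <-] := convex_sum (v := fun j => set_val (p j i)) (@vD i) Sl.
  by move=> j _; exists (p j i) => //; exact: Dp.
by exists z.
Qed.

Variable (T : forall i, P -> set (X i)).
Arguments T : clear implicits.
Hypotheses (clT : forall i, closed (graph (T i : P -> set (subspaces X i))))
  (TD : forall i x, T i x `<=` D i)
  (T0 : forall i x, prodset x -> T i x !=set0)
  (vT : forall i x, prodset x -> convex_subset (T i x)).

Lemma closed_graphT (S : topologicalType) (f g : S -> P) i :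
  continuous f -> continuous g -> closed [set s | T i (f s) (g s i)].
Proof.
move=> cf cg.
apply: (@preimage_closed S (P * subspaces X i)%type (fun s => (f s, g s i))
  (graph (T i : P -> set (subspaces X i)))); last exact: clT.
have ci : continuous (fun s => g s i : subspaces X i).
  move=> s; apply: (@continuous_comp S P (subspaces X i) g (fun x => x i)).
    exact: cg.
  exact: (@continuous_coord I (subspaces X)).
by move=> s _; exact: cvg_pair (cf s) (ci s).
Qed.

Lemma closed_diff (S : topologicalType) (f g : S -> P) i (U : set (E i)) :
  closed U -> continuous f -> continuous g ->
  closed [set s | U (set_val (f s i) - set_val (g s i))].
Proof.
move=> cU cf cg.
apply: (@preimage_closed S (E i) (fun s => set_val (f s i) - set_val (g s i)));
  last exact: cU.
have cv (h : S -> P) : continuous h ->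
    continuous (fun s => set_val (h s i) : E i).
  move=> ch s; apply: (@continuous_comp S P (E i) h (fun x => set_val (x i))).
    exact: ch.
  exact: continuous_val_coord.
by move=> s _; apply: continuous_sub (cv f cf) (cv g cg) s.
Qed.

Definition box (U : forall i, set (E i)) : set (prod_topology E) :=
  [set z | forall i, U i (z i)].

(** Requiring the box to be a neighborhood of 0 in the product leaves only
    finitely many coordinates constrained, so that finitely many translates of
    it cover the compact product of the [D i]. *)
Lemma approximate_fixed_point (U : forall i, set (E i)) :
  (forall i, closed (U i)) -> (forall i, convex_set (U i)) ->
  nbhs ((fun=> 0) : prod_topology E) (box U) ->
  exists2 x, prodset x & exists2 y, prodset y &
    forall i, T i x (y i) /\ U i (set_val (x i) - set_val (y i)).
Proof.
move=> clU vU U0.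
have [n [p [Dp pcov]]] : exists n (p : 'I_n.+1 -> P),
    (forall j, prodset (p j)) /\ forall y, prodset y ->
    exists j, forall i, U i (set_val (p j i) - set_val (y i)).
  apply: (@compact_cover_nbhs P prodset
    (fun q => [set y | forall i, U i (set_val (q i) - set_val (y i))])).
  - exact: compact_prodset.
  - exact: prodset_neq0.
  - move=> q _.
    pose d (y : P) : prod_topology E := fun i => set_val (q i) - set_val (y i).
    have cd : continuous d.
      apply: continuous_to_prod => i.
      apply: (@continuous_sub R (E i) P
        (fun=> set_val (q i)) (fun y => set_val (y i))).
        exact: cst_continuous.
      exact: continuous_val_coord.
    apply: (cd q (box U)).
    suff -> : d q = fun=> 0 by [].
    by apply/functional_extensionality_dep => i; rewrite /d subrr.
(* The point l gets the label j when (l, (x, y)) is in C j for some x and y in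
   the product of the D i.  The relation C j is closed, hence so is its
   projection. *)
pose C j := [set z : 'rV[R]_n.+1 * (P * P) | forall i,
  [/\ set_val (z.2.1 i) = \sum_k z.1 ord0 k *: set_val (p k i),
      T i z.2.1 (z.2.2 i) & U i (set_val (p j i) - set_val (z.2.2 i))]].
have cx : continuous (fun z : 'rV[R]_n.+1 * (P * P) => z.2.1).
  by move=> z; apply: (continuous_comp cvg_snd cvg_fst).
have cy : continuous (fun z : 'rV[R]_n.+1 * (P * P) => z.2.2).
  by move=> z; apply: (continuous_comp cvg_snd cvg_snd).
have clC j : closed (C j).
  have -> : C j = \bigcap_i
     ([set z : 'rV[R]_n.+1 * (P * P) |
         set_val (z.2.1 i) = \sum_k z.1 ord0 k *: set_val (p k i)] `&`
      ([set z : 'rV[R]_n.+1 * (P * P) | T i z.2.1 (z.2.2 i)] `&`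
       [set z : 'rV[R]_n.+1 * (P * P) |
         U i (set_val (p j i) - set_val (z.2.2 i))])).
    rewrite eqEsubset; split=> z Cz i; first by move=> _; have [] := Cz i.
    by have [? []] := Cz i Logic.I.
  apply: closed_bigI => i _; apply: closedI; [|apply: closedI].
  - apply: closed_eq_fun; first exact: hE.
      move=> z; apply: (@continuous_comp _ P (E i)
        (fun z => z.2.1) (fun x => set_val (x i))); first exact: cx.
      exact: continuous_val_coord.
    apply: (@continuous_big (E i)) => [|k _]; first exact: add_continuous.
    apply: continuous_scale; last exact: cst_continuous.
    move=> z.
    apply: (@continuous_comp _ 'rV[R]_n.+1 R^o fst (fun l => l ord0 k)).
      exact: cvg_fst.
    exact: coord_continuous.
  - exact: (closed_graphT (i := i) cx cy).
  - exact: (closed_diff (clU i) (@cst_continuous _ _ (p j)) cy).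
have [||l Sl Fl] := @simplex_labelling R n
    (fun j => [set l | exists2 z, (prodset `*` prodset) z & C j (l, z)]).
- move=> j; apply: closed_proj => //.
  by apply: compact_setX; exact: compact_prodset.
- move=> l Sl; have [x Dx xE] := prodset_mix Dp Sl.
  have [y Ty] := dependent_choice_fun (fun i => T0 i Dx).
  have Dy : prodset y by move=> i; exact: TD (Ty i).
  by have [j yj] := pcov y Dy; exists j, (x, y).
have [x Dx xE] := prodset_mix Dp Sl.
have /choice[y yP] j : exists y : P, l ord0 j != 0 ->
    forall i, T i x (y i) /\ U i (set_val (p j i) - set_val (y i)).
  have [->|[[x' y] _ Cxy]] := Fl j; first by exists x; rewrite eqxx.
  exists y => _ i; have [_ /= Tx' Uy] := Cxy i; split=> //.
  (* Both points are the combination of the p j with weights l. *)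
  suff -> : x = x' by [].
  apply/functional_extensionality_dep => k; apply: val_inj.
  by have [/= x'k _ _] := Cxy k; rewrite -!set_valE xE.
have /dependent_choice_fun[z zP] i : exists z, T i x z /\
    set_val z = \sum_j l ord0 j *: set_val (y j i).
  have [|z Tz <-] :=
    convex_sum (v := fun j => set_val (y j i)) (vT (i := i) Dx) Sl.
    by move=> j lj; exists (y j i) => //; have [] := yP j lj i.
  by exists z.
exists x => //; exists z => [i|i]; first by have [/TD] := zP i.
have [Tz zE] := zP i; split=> //; rewrite xE zE -sumrB.
under eq_bigr do rewrite -scalerBr.
by apply: convex_sum => // j lj; have [] := yP j lj i.
Qed.

Definition only_at i (V : set (E i)) : forall k, set (E k) :=
  @dfwith {classic I} (fun k => set (E k)) (fun=> setT) i V.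
Arguments only_at {i} V k.

Lemma only_atP i (V : set (E i)) (Q : forall k, set (E k) -> Prop) :
  Q i V -> (forall k, Q k setT) -> forall k, Q k (only_at V k).
Proof. by move=> QV QT k; rewrite /only_at; case: (@dfwithP {classic I}). Qed.

(** The Kakutani-Fan-Glicksberg theorem.  The pairs of an approximate fixed
    point x and of a nearby y in T x have, by compactness, a limit for the
    neighborhoods shrinking to 0; in it both components agree, as the [E i] are
    Hausdorff. *)
Theorem product_fixed_point : exists2 x, prodset x & forall i, T i x (x i).
Proof.
pose good (U : forall i, set (E i)) := [/\ forall i, closed (U i),
  forall i, convex_set (U i) & nbhs ((fun=> 0) : prod_topology E) (box U)].
pose Q (U : {U | good U}) := [set z : P * P | forall i,
  T i z.1 (z.2 i) /\ sval U i (set_val (z.1 i) - set_val (z.2 i))].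
have goodT : good (fun=> setT).
  split=> [i|i|]; [exact: closedT|exact/convex_setP|exact: filterS filterT].
have clQ U : closed (Q U).
  have -> : Q U = \bigcap_i ([set z : P * P | T i z.1 (z.2 i)] `&`
      [set z : P * P | sval U i (set_val (z.1 i) - set_val (z.2 i))]).
    rewrite eqEsubset; split=> z Qz i; first by move=> _; exact: Qz.
    exact: Qz Logic.I.
  have [Ucl _ _] := svalP U.
  apply: closed_bigI => i _; apply: closedI.
    by apply: (closed_graphT (i := i)) => z; [exact: cvg_fst|exact: cvg_snd].
  by apply: (closed_diff (Ucl i)) => z; [exact: cvg_fst|exact: cvg_snd].
have [||[U [Ucl Uv U0]]|[U [Ucl Uv U0]] [V [Vcl Vv V0]]|[x y] [/= Dx _] xyQ] :=
    @compact_directed (P * P)%type _ (prodset `*` prodset) Q.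
- by apply: compact_setX; exact: compact_prodset.
- by constructor; exists (fun=> setT).
- have [x Dx [y Dy xy]] := approximate_fixed_point Ucl Uv U0.
  by exists (x, y).
- have gUV : good (fun i => U i `&` V i).
    split=> [i|i|]; [exact: closedI|exact: convex_setI|].
    by apply: filterS (filterI U0 V0) => z [Uz Vz] i; split.
  exists (exist good _ gUV) => z Qz.
  by split=> i; have [? []] := Qz i.
have Qxy U : Q U (x, y) by exact: clQ.
suff xy : x = y.
  by exists x => // i; have [/= + _] := Qxy (exist good _ goodT) i; rewrite -xy.
apply/functional_extensionality_dep => i; apply: val_inj.
apply: (hE (i := i)) => A B xA yB; exists (set_val (x i)); split.
  exact: nbhs_singleton.
have : nbhs (0 : E i) [set v | B (set_val (y i) + v)].
  have c : continuous (fun v : E i => set_val (y i) + v).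
    by apply: continuous_add; [exact: cst_continuous|move=> v; exact: cvg_id].
  by apply: c; rewrite addr0.
move=> /closed_convex_nbhs[V [V0 Vcl Vv VB]].
have gV : good (only_at V).
  split=> [k|k|].
  - by apply: (only_atP (Q := fun k => @closed (E k))) => // ?; exact: closedT.
  - apply: (only_atP (Q := fun k (A : set (E k)) => convex_set A)) => // ?.
    exact/convex_setP.
  have : nbhs ((fun=> 0) : prod_topology E) ((fun z => z i) @^-1` V).
    exact: (@continuous_coord I E i (fun=> 0) V).
  apply: (@filterS _ _ (@nbhs_filter (prod_topology E) _)) => z Vz.
  by apply: (only_atP (Q := fun k A => A (z k))).
have [_ /=] := Qxy (exist good _ gV) i; rewrite /only_at dfwith_in => /VB/=.
by rewrite addrC subrK.
Qed.

End fixed_point.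

(** * Equilibria *)

Lemma hausdorff_injective (S T : topologicalType) (f : S -> T) :
  continuous f -> injective f -> hausdorff_space T -> hausdorff_space S.
Proof.
move=> cf fI hT p q pq; apply: fI; apply: hT => A B pA qB.
by have [z [Az Bz]] := pq _ _ (cf p A pA) (cf q B qB); exists (f z).
Qed.

Lemma closure_corrS (S T : topologicalType) (H K : S -> set T) :
  (forall x, H x `<=` K x) -> forall x, closure_corr H x `<=` closure_corr K x.
Proof. by move=> HK x y; apply: closureS => -[x' y']; exact: HK. Qed.

Section enlargement.
Context {R : realType} {S : topologicalType} {E : tvsType R} {Y : set E}.
Implicit Types (H K : S -> set Y) (D : set Y) (V : set E).

Lemma enlargeS H K D V U : (forall x, H x `<=` K x) -> V `<=` U ->
  forall x, enlarge H D V x `<=` enlarge K D U x.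
Proof.
move=> HK VU x y [[a [z /HK Kz za] [b /VU Ub ab]] Dy]; split=> //.
by exists a; [exists z|exists b].
Qed.

Lemma closure_enlarge_sub H D V : hausdorff_space E -> compact D ->
  forall x, closure_corr (enlarge H D V) x `<=` D.
Proof.
move=> hE cD x y Hxy.
have hY : hausdorff_space Y.
  apply: (hausdorff_injective (f := set_val)) hE; last exact: val_inj.
  exact: initial_continuous.
have clD : closed [set z : S * Y | D z.2].
  apply: preimage_closed; last exact: compact_closed.
  by move=> z _; exact: cvg_snd.
by apply: (clD (x, y)); apply: closureS Hxy => -[x' y'] [].
Qed.

(** A point of the graph of the V-enlargement of [H] that is close to [(x, y)]
    differs by an element of V from a point of the graph of [H]; so this one is
    close to [(x, y)] as well when V is small. *)
Lemma closure_enlarge_limit H D x y :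
  (forall V, open_nbhs (0 : E) V -> absolutely_convex V -> symmetric_set V ->
     closure_corr (enlarge H D V) x y) -> closure_corr H x y.
Proof.
move=> HV B [[B1 B2] /= [xB1 [_ [[O oO <-] /= Oy OB2]]] BB].
have [V [V0 cV sV VO]] : exists V : set E,
  [/\ open_nbhs 0 V, absolutely_convex V, symmetric_set V &
    forall a b, V a -> V b -> O (set_val y + (a + b))].
  apply: (abs_convex_nbhs (U := [set v | O (set_val y + v)])).
  have c : continuous (fun v : E => set_val y + v).
    by apply: continuous_add; [exact: cst_continuous|move=> v; exact: cvg_id].
  by apply: (c 0 O); rewrite addr0; exact: open_nbhs_nbhs.
have yV : nbhs y [set y' : Y | V (set_val y' - set_val y)].
  have c : continuous (fun y' : Y => set_val y' - set_val y : E).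
    by apply: continuous_sub; [exact: initial_continuous|exact: cst_continuous].
  by apply: c; rewrite subrr; exact: open_nbhs_nbhs.
have [|[x' y'] [[[_ [h Hh <-] [b Vb hb]] _] [/= B1x' Vy']]] :=
  HV V V0 cV sV (B1 `*` [set y' : Y | V (set_val y' - set_val y)]).
  by exists (B1, [set y' : Y | V (set_val y' - set_val y)]).
exists (x', h); split=> //; apply: BB; split=> //; apply: OB2 => /=.
have -> : set_val h = set_val y + ((set_val y' - set_val y) - b).
  by rewrite addrA [set_val y + _]addrC subrK -hb addrK.
by apply: VO => //; exact: sV.
Qed.

End enlargement.

Theorem theorem2 (R : realType) (I : Type) (E : I -> tvsType R)
    (X : forall i, set (E i)) (D : forall i, set (X i))
    (G : fuzzy_economy R (subspaces X))
    (W := fun i => [set x | cutA G i x `&` cutP G i x !=set0])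
    (hE : forall i, hausdorff_space (E i))
    (hX : forall i, [/\ X i !=set0, compact (X i) & convex_set (X i)])
    (hD : forall i, [/\ D i !=set0, compact (D i) & convex_subset (D i)])
    (hcut : forall i x,
      [/\ cutB G i x !=set0, convex_subset (cutB G i x),
          convex_subset (cutA G i x), convex_subset (cutP G i x)
        & cutA G i x `&` cutP G i x `<=` cutB G i x])
    (hW : forall i, open (W i))
    (hH : forall i, almost_w_usc_on (W i) (D i) (cutAP G i))
    (hHV : forall i (V : set (E i)),
      open_nbhs (0 : E i) V -> absolutely_convex V -> symmetric_set V ->
      forall x, W i x ->
        closure_corr (enlarge (cutAP G i) (D i) V) x !=set0 /\
        convex_subset (closure_corr (enlarge (cutAP G i) (D i) V) x))
    (hB : forall i, almost_w_usc (D i) (cutB G i))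
    (hBV : forall i (V : set (E i)),
      open_nbhs (0 : E i) V -> absolutely_convex V -> symmetric_set V ->
      forall x,
        closure_corr (enlarge (cutB G i) (D i) V) x !=set0 /\
        convex_subset (closure_corr (enlarge (cutB G i) (D i) V) x))
    (hfix : forall i x, ~ closure_corr (cutAP G i) x (x i)) :
  exists x : prod_topology (subspaces X),
    (forall i, D i (x i)) /\ fuzzy_equilibrium G x.
Proof.
have D0 i : D i !=set0 by case: (hD i).
have cD i : compact (D i) by case: (hD i).
have vD i : convex_subset (D i) by case: (hD i).
pose HV i V := closure_corr (enlarge (cutAP G i) (D i) V).
pose BV i V := closure_corr (enlarge (cutB G i) (D i) V).
have HB i V x : HV i V x `<=` BV i V x.
  apply: closure_corrS => x'; apply: enlargeS => // z.
  by have [_ _ _ _] := hcut i z.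
pose T (V : forall i, set (E i)) i x :=
  [set y | BV i (V i) x y /\ (W i x -> HV i (V i) x y)].
pose good (V : forall i, set (E i)) := forall i,
  [/\ open_nbhs 0 (V i), absolutely_convex (V i) & symmetric_set (V i)].
(* Off the open set W i, T is the enlargement of B i; over W i it is that of the
   smaller correspondence.  Hence the graph is closed. *)
have clT V i : closed (graph (T V i : _ -> set (subspaces X i))).
  have -> : graph (T V i) = closure (graph (enlarge (cutB G i) (D i) (V i))) `&`
      (fst @^-1` (~` W i) `|`
       closure (graph (enlarge (cutAP G i) (D i) (V i)))).
    rewrite eqEsubset; split=> -[x y] [Bxy q]; split=> //.
      by have [Wx|] := pselect (W i x); [right; exact: q|left].
    by case: q => [//|Hxy] _.
  apply: closedI; first exact: closed_closure.
  apply: closedU; last exact: closed_closure.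
  apply: preimage_closed; last exact: open_closedC.
  by move=> z _; exact: cvg_fst.
have TD V i x : T V i x `<=` D i.
  by move=> y [By _]; exact: closure_enlarge_sub By.
have TE V i x :
    T V i x = if pselect (W i x) then HV i (V i) x else BV i (V i) x.
  case: pselect => Wx; rewrite eqEsubset; split=> y.
  - by move=> [_]; exact.
  - by move=> Hy; split=> //; exact: HB.
  - by case.
  - by split.
pose Q (V : {V | good V}) := [set x | forall i, T (sval V) i x (x i)].
have [||||x Dx xQ] :=
    @compact_directed (prod_topology (subspaces X)) _ (prodset D) Q.
- exact: compact_prodset.
- constructor; exists (fun=> setT) => i; split=> //.
    by split=> //; exact: openT.
  by split=> //; exact/convex_setP.
- move=> [V gV].
  have TV i x : T V i x !=set0 /\ convex_subset (T V i x).
    rewrite TE; have [V0 cV sV] := gV i.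
    by case: pselect => Wx; [exact: hHV|exact: hBV].
  have [x Dx Tx] := product_fixed_point hE D0 cD vD (clT V) (TD V)
    (fun i x _ => (TV i x).1) (fun i x _ => (TV i x).2).
  by exists x.
- move=> [U gU] [V gV].
  have gUV : good (fun i => U i `&` V i).
    move=> i; have [U0 [vU bU] sU] := gU i; have [V0 [vV bV] sV] := gV i; split.
    - exact: open_nbhsI.
    - split; first exact: convex_setI.
      by move=> a v a1 [Uv Vv]; split; [exact: bU|exact: bV].
    - by move=> v [Uv Vv]; split; [exact: sU|exact: sV].
  exists (exist good _ gUV) => x Qx.
  split=> i; have [/= Bx Hx] := Qx i; split=> /=.
  - by move: Bx; apply: closure_corrS => z; apply: enlargeS => // ? [].
  - by move=> /Hx; apply: closure_corrS => z; apply: enlargeS => // ? [].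
  - by move: Bx; apply: closure_corrS => z; apply: enlargeS => // ? [].
  - by move=> /Hx; apply: closure_corrS => z; apply: enlargeS => // ? [].
(* The fixed points for the family made of V at i and of E k elsewhere form a
   closed set, which therefore contains the limit point x. *)
have Tx i (V : set (E i)) : open_nbhs 0 V -> absolutely_convex V ->
    symmetric_set V -> BV i V x (x i) /\ (W i x -> HV i V x (x i)).
  move=> V0 cV sV.
  have gV : good (only_at V).
    apply: (only_atP (Q := fun k (A : set (E k)) =>
      [/\ open_nbhs 0 A, absolutely_convex A & symmetric_set A])) => [//|k].
    split=> //; first by split=> //; exact: openT.
    by split=> //; exact/convex_setP.
  have clQ : closed (Q (exist good _ gV)).
    have -> : Q (exist good _ gV) = \bigcap_k [set x | T (only_at V) k x (x k)].
      rewrite eqEsubset; split=> z Qz k; first by move=> _; exact: Qz.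
      exact: Qz Logic.I.
    apply: closed_bigI => k _.
    by apply: (closed_graphT (clT (only_at V)) (f := id) (g := id)) => z;
      exact: cvg_id.
  by have := clQ x (xQ _) i; rewrite /= /T /only_at/= dfwith_in.
exists x; split=> // i; split.
  apply: (closure_enlarge_limit (D := D i)) => V V0 cV sV.
  exact: (Tx i V V0 cV sV).1.
apply/eqP; apply: contrapT => /negP/set0P Wx.
apply: (@hfix i x); apply: (closure_enlarge_limit (D := D i)) => V V0 cV sV.
exact: (Tx i V V0 cV sV).2 Wx.
Qed.
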